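(* For a ring $R$, the following conditions are equivalent. (1) $R$ is right perfect. (2) Every right $R$-module has a max-projective cover. (3) Every semisimple right $R$-module has a max-projective cover.
   Context: Rings are associative with identity; modules are unital right modules. A right $R$-module $M$ is max-projective if for every maximal right ideal $I$ of $R$, every homomorphism $M\to R/I$ factors through the canonical projection $R\to R/I$. A submodule $K$ of $P$ is small (superfluous) if $K+L\neq P$ for every proper submodule $L$ of $P$. A max-projective cover of a right $R$-module $M$ is an epimorphism $f:P\to M$ with $P$ max-projective and $\ker f$ small in $P$. A ring is right perfect if every right module has a projective cover. *)

(* Defs.v *)
From HB Require Import structures.
From mathcomp Require Import all_boot all_algebra.

Set Implicit Arguments.
Unset Strict Implicit.
Unset Printing Implicit Defensive.

Import GRing.Theory.
Local Open Scope quotient_scope.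
Local Open Scope ring_scope.

(* The setting is classical: with the axioms of mathcomp.classical.boolp every
   subset is a boolean predicate and every type is a choiceType, so that
   [submodClosed M] ranges over all submodules of M and [lmodType] over all
   modules. Rings are [pzRingType]: associative, unital, possibly zero. *)

(* A right R-module is a left module over the converse ring: for x : M and
   r : R, the product x r is (r : R^c) *: x. *)
Notation rmodType R := (lmodType R^c).

(* R as a right module over itself; here (r : R^c) *: x = x * r in R, so the
   submodules of [right_regular R] are the right ideals of R. *)
Notation right_regular R := (R^c)^o.

Section SubmoduleQuotient.
Variables (R : pzRingType) (V : lmodType R) (I : submodClosed V).

(* A submodule seen as an additive subgroup, as required by the library's
   quotients, which carry the additive group structure only. *)
Definition submod_group : {pred V} := [pred x | x \in I].

Fact submod_group_closed : zmod_closed submod_group.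
Proof.
split=> [|x y]; rewrite !inE ?rpred0 // => Ix Iy.
by rewrite -scaleN1r rpredD // rpredZ.
Qed.

HB.instance Definition _ :=
  GRing.isZmodClosed.Build V submod_group submod_group_closed.

Definition quotmod := {ideal_quot submod_group}.

HB.instance Definition _ := GRing.Zmodule.on quotmod.

Definition quotmod_proj (x : V) : quotmod := \pi_{ideal_quot submod_group} x.

Definition quotmod_scale (a : R) (u : quotmod) : quotmod :=
  quotmod_proj (a *: repr u).

Fact quotmod_projB : zmod_morphism quotmod_proj.
Proof. by move=> x y; rewrite /quotmod_proj raddfB. Qed.

HB.instance Definition _ :=
  GRing.isZmodMorphism.Build V quotmod quotmod_proj quotmod_projB.

Fact quotmod_projP u : quotmod_proj (repr u) = u.
Proof. exact: reprK. Qed.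

Fact quotmod_scale_proj a x :
  quotmod_scale a (quotmod_proj x) = quotmod_proj (a *: x).
Proof.
apply/eqP; rewrite -Quotient.idealrBE inE -scalerBr rpredZ //.
by rewrite -[_ \in I]/(_ \in submod_group) Quotient.idealrBE reprK.
Qed.

Fact quotmod_scaleA a b u :
  quotmod_scale a (quotmod_scale b u) = quotmod_scale (a * b) u.
Proof. by rewrite -[u]quotmod_projP !quotmod_scale_proj scalerA. Qed.

Fact quotmod_scale1 : left_id 1 quotmod_scale.
Proof. by move=> u; rewrite -[u]quotmod_projP quotmod_scale_proj scale1r. Qed.

Fact quotmod_scaleDr : right_distributive quotmod_scale +%R.
Proof.
move=> a u v; rewrite -[u]quotmod_projP -[v]quotmod_projP -raddfD.
by rewrite !quotmod_scale_proj scalerDr raddfD.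
Qed.

Fact quotmod_scaleDl u : {morph quotmod_scale^~ u : a b / a + b}.
Proof.
by move=> a b; rewrite -[u]quotmod_projP !quotmod_scale_proj scalerDl raddfD.
Qed.

HB.instance Definition _ := GRing.Zmodule_isLmodule.Build R quotmod
  quotmod_scaleA quotmod_scale1 quotmod_scaleDr quotmod_scaleDl.

Fact quotmod_projZ : scalable quotmod_proj.
Proof. by move=> a x; rewrite -quotmod_scale_proj. Qed.

HB.instance Definition _ :=
  GRing.isScalable.Build R V quotmod *:%R quotmod_proj quotmod_projZ.

End SubmoduleQuotient.

Section Kernel.
Variables (R : pzRingType) (U V : lmodType R) (f : {linear U -> V}).

Definition kernel : {pred U} := [pred x | f x == 0].

Fact kernel_submod_closed : submod_closed kernel.
Proof.
split=> [|a x y]; rewrite !inE ?linear0 // => /eqP fx0 /eqP fy0.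
by rewrite linearP fx0 fy0 scaler0 addr0.
Qed.

HB.instance Definition _ := GRing.isSubmodClosed.Build R U kernel
  (GRing.submod_closed_semi kernel_submod_closed).

End Kernel.

Section Submodules.
Variables (R : pzRingType) (M : lmodType R).
Implicit Types K L S : submodClosed M.

Definition proper_submod L := exists x, x \notin L.

Definition maximal_submod K :=
  proper_submod K /\
  forall L, {subset K <= L} -> proper_submod L -> {subset L <= K}.

(* [addsm_full K L] states K + L = M. *)
Definition addsm_full K L :=
  forall x, exists k l, [/\ k \in K, l \in L & x = k + l].

Definition small K := forall L, proper_submod L -> ~ addsm_full K L.

Definition simple_submod S :=
  (exists2 x, x \in S & x != 0) /\
  forall L, {subset L <= S} ->
    (forall x, x \in L -> x = 0) \/ {subset S <= L}.

(* M is the sum of its simple submodules. *)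
Definition semisimple :=
  forall x : M, exists2 s : seq M,
    x = \sum_(y <- s) y &
    forall y, y \in s -> exists2 S : submodClosed M, simple_submod S & y \in S.

End Submodules.

Definition surjective (A B : Type) (f : A -> B) := forall y, exists x, f x = y.

Section RightModules.
Variable R : pzRingType.

Definition projective (P : rmodType R) :=
  forall (A B : rmodType R) (g : {linear A -> B}) (f : {linear P -> B}),
    surjective g -> exists h : {linear P -> A}, f =1 g \o h.

Definition max_projective (M : rmodType R) :=
  forall I : submodClosed (right_regular R), maximal_submod I ->
  forall f : {linear M -> quotmod I},
    exists g : {linear M -> right_regular R}, f =1 quotmod_proj I \o g.

Definition has_projective_cover (M : rmodType R) :=
  exists (P : rmodType R) (f : {linear P -> M}),
    [/\ projective P, surjective f & small (kernel f)].

Definition has_max_projective_cover (M : rmodType R) :=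
  exists (P : rmodType R) (f : {linear P -> M}),
    [/\ max_projective P, surjective f & small (kernel f)].

Definition right_perfect := forall M : rmodType R, has_projective_cover M.

End RightModules.

(* Main.v *)
Require Import Defs.
From HB Require Import structures.
From mathcomp Require Import all_boot all_algebra.
From mathcomp Require Import boolp classical_sets functions.

Set Implicit Arguments.
Unset Strict Implicit.
Unset Printing Implicit Defensive.

Import GRing.Theory.
Local Open Scope ring_scope.

(** Only the passage from covers of semisimple modules to right perfectness
    has content. It takes place over S := R^c, where right R-modules are left
    S-modules; J denotes the Jacobson radical of S.

    The ring S is semilocal ([covers_semilocal]). Let f : P -> S/I be a
    max-projective cover with I maximal, let f y be the class of 1, and lift f
    to g : P -> S. Then g y is outside I, whereas I (g y) lies in the image of
    the small submodule ker f, hence in J. So the elements annihilated modulo J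
    by a maximal left ideal lie together in no maximal left ideal, and 1 is a
    combination of them: S/J is semisimple. Consequently V/K is semisimple
    whenever J V lies in K, and a max-projective P lifts maps to S/J, not only
    maps to simple quotients of S ([max_projective_lift_jacobson]).

    The main step is a uniqueness property ([cover_free_module]). Let F be free
    and f : P -> M a max-projective cover of a module M isomorphic to F/JF. The
    projection F -> M lifts to q : F -> P, and q is onto because ker f is
    small. Each coordinate of F factors modulo J through M, so it lifts to a
    linear form on P, and on the vectors q b, for b in the basis, these forms
    take the values of the identity matrix modulo J. By Nakayama's lemma q is
    injective. Hence F and P are isomorphic; taking M = F/JF, the submodule JF
    is small in F ([free_radical_small]).

    Given any module N, take F free on N, let phi : F -> N be the canonical
    surjection and put K := ker phi + JF. Since F/JF is semisimple, K has a
    complement K' modulo JF, and F/JF is F/K * F/K'. The product P * P' of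
    max-projective covers of both factors is a max-projective cover of F/JF,
    thus P * P' is isomorphic to F and P is projective. Lifting P -> F/K to
    P -> F and composing with phi gives a map P -> N, which is onto because JF
    is small in F, and whose kernel lies in the small kernel of P -> F/K. *)

(** * Submodules and linear maps given by predicates and functions *)

Section PropSubmodule.
Variables (S : pzRingType) (V : lmodType S) (A : V -> Prop).

Definition is_submod := A 0 /\ forall a x y, A x -> A y -> A (a *: x + y).

Definition submod_of (_ : is_submod) : {pred V} := [pred x | `[<A x>]].

Variable A_submod : is_submod.

Lemma submod_ofP x : reflect (A x) (x \in submod_of A_submod).
Proof. exact: asboolP. Qed.

Fact submod_of_closed : submod_closed (submod_of A_submod).
Proof.
case: A_submod => A0 Alin; split=> [|a x y]; first exact/submod_ofP.
by move=> /submod_ofP Ax /submod_ofP Ay; apply/submod_ofP/Alin.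
Qed.

HB.instance Definition _ := GRing.isSubmodClosed.Build S V
  (submod_of A_submod) (GRing.submod_closed_semi submod_of_closed).

End PropSubmodule.

Definition linear_of (S : pzRingType) (U V : lmodType S) (f : U -> V)
    (f_lin : linear f) : {linear U -> V} :=
  HB.pack f (GRing.isLinear.Build S U V *:%R f f_lin).

Lemma linear_ofE (S : pzRingType) (U V : lmodType S) (f : U -> V)
    (f_lin : linear f) x : linear_of f_lin x = f x.
Proof. by []. Qed.

(** * Maximal submodules avoiding a set *)

Section Zorn.
Variables (S : pzRingType) (V : lmodType S).
Implicit Types (A L : submodClosed V) (E : V -> Prop).

Lemma add_line_submod L (v : V) :
  is_submod (fun x => exists r, x - r *: v \in L).
Proof.
split=> [|a x y [r xL] [r' yL]].
  by exists 0; rewrite scale0r subr0 rpred0.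
exists (a * r + r'); rewrite scalerDl -scalerA opprD addrACA -scalerBr.
by rewrite rpredD ?rpredZ.
Qed.

(** This form of Zorn's lemma serves twice: with E = {1} it gives maximal left
    ideals, with E = K minus A a complement of K modulo A. Maximality is
    expressed by the failure of L + S v to avoid E. *)
Lemma maximal_disjoint_submod A E : (forall x, x \in A -> ~ E x) ->
  exists L, [/\ {subset A <= L}, forall x, x \in L -> ~ E x &
    forall v, v \notin L -> exists r l, l \in L /\ E (r *: v + l)].
Proof.
move=> AE.
pose T := {L : submodClosed V | {subset A <= L} /\ forall x, x \in L -> ~ E x}.
pose le (L1 L2 : T) : bool := `[< {subset sval L1 <= sval L2} >].
pose T0 : T := exist _ A (conj (fun _ => id) AE).
have [||C totC|[L [AL LE]] maxL] := @ZL_preorder T T0 le.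
- by move=> L; apply/asboolP.
- by move=> L1 L2 L3 /asboolP s12 /asboolP s23; apply/asboolP => x /s12/s23.
- have [[L0 CL0]|C0] := pselect (exists L0 : T, C L0); last first.
    by exists T0 => L CL; case: C0; exists L.
  have Uax : is_submod (fun x => exists2 L : T, C L & x \in sval L).
    split=> [|a x y [L1 CL1 xL1] [L2 CL2 yL2]].
      by exists L0; last exact: rpred0.
    have [/asboolP s|/asboolP s] := totC _ _ CL1 CL2.
      by exists L2 => //; apply/rpredD/yL2/rpredZ/s.
    by exists L1 => //; apply/rpredD/s/yL2/rpredZ.
  have UA : {subset A <= submod_of Uax}.
    move=> x Ax; apply/submod_ofP; exists L0 => //.
    by have [AL0 _] := svalP L0; exact: AL0.
  have UE x : x \in submod_of Uax -> ~ E x.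
    by move=> /submod_ofP[L CL]; have [_] := svalP L; apply.
  exists (exist _ (submod_of Uax : submodClosed V) (conj UA UE)) => L CL.
  by apply/asboolP => x xL; apply/submod_ofP; exists L.
exists L; split=> // v vL; apply: contrapT => noE.
pose L' : submodClosed V := submod_of (add_line_submod L v).
have LL' : {subset L <= L'}.
  by move=> x xL; apply/submod_ofP; exists 0; rewrite scale0r subr0.
have L'E x : x \in L' -> ~ E x.
  move=> /submod_ofP[r xL] Ex; apply: noE; exists r, (x - r *: v); split=> //.
  by rewrite addrC subrK.
have AL' : {subset A <= L'} by move=> x /AL/LL'.
have /(maxL (exist _ L' (conj AL' L'E)))/asboolP /= :
  le (exist _ L (conj AL LE)) (exist _ L' (conj AL' L'E)) by exact/asboolP.
move=> L'L; case/negP: vL; apply: L'L; apply/submod_ofP; exists 1.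
by rewrite scale1r subrr rpred0.
Qed.

End Zorn.

(** * Small submodules and quotients *)

Section Small.
Variable S : pzRingType.
Implicit Types U V W : lmodType S.

Lemma maximal_submodP V (K : submodClosed V) (v w : V) :
  maximal_submod K -> v \notin K -> exists r, w - r *: v \in K.
Proof.
move=> [_ maxK] vK; apply: contrapT => noR.
pose L : submodClosed V := submod_of (add_line_submod K v).
have wL : w \notin L by apply/negP => /submod_ofP.
case/negP: vK; apply: (maxK L) => [x xK||]; last first.
- by apply/submod_ofP; exists 1; rewrite scale1r subrr rpred0.
- by exists w.
by apply/submod_ofP; exists 0; rewrite scale0r subr0.
Qed.

Lemma preim_submod U V (f : {linear U -> V}) (L : submodClosed V) :
  is_submod (fun x => f x \in L).
Proof.
by split=> [|a x y fx fy]; rewrite ?linear0 ?rpred0 // linearP rpredD ?rpredZ.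
Qed.

(** The image under f of a small submodule K is small: if f K + L is
    everything then so is K + f^-1 L, hence f^-1 L, hence f K lies in L. *)
Lemma small_image U V (f : {linear U -> V}) (K : submodClosed U)
    (L : submodClosed V) : small K ->
  (forall v, exists k l, [/\ k \in K, l \in L & v = f k + l]) ->
  forall v, v \in L.
Proof.
move=> smallK full.
have preT u : f u \in L.
  apply: contrapT => /negP fuL.
  apply: (smallK (submod_of (preim_submod f L))).
    by exists u; apply/submod_ofP/negP.
  move=> x; have [k [l [kK lL fx]]] := full (f x).
  exists k, (x - k); split=> //; last by rewrite addrC subrK.
  by apply/submod_ofP; rewrite linearB fx addrC addKr.
by move=> v; have [k [l [kK lL ->]]] := full v; rewrite rpredD.
Qed.

Lemma small_full U (K L : submodClosed U) : small K -> addsm_full K L ->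
  forall u, u \in L.
Proof.
move=> smallK full u; apply: contrapT => /negP uL.
by apply: (smallK L) => //; exists u.
Qed.

(** If f k were outside I, then I + f K would be everything by maximality of I,
    although f K is small and I is proper. *)
Lemma small_sub_maximal U V (f : {linear U -> V}) (K : submodClosed U)
    (I : submodClosed V) k :
  small K -> maximal_submod I -> k \in K -> f k \in I.
Proof.
move=> smallK maxI kK; apply: contrapT => /negP fkI.
have [[v /negP vI] _] := maxI; apply/vI/(small_image smallK (f := f)) => w.
have [r wI] := maximal_submodP w maxI fkI.
exists (r *: k), (w - r *: f k); split=> //; first exact: rpredZ.
by rewrite linearZ /= addrC subrK.
Qed.

Lemma small_sub U (K K' : submodClosed U) :
  {subset K' <= K} -> small K -> small K'.
Proof.
move=> sK smallK L propL full; apply: smallK propL _ => x.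
by have [k [l [/sK kK lL ->]]] := full x; exists k, l.
Qed.

Lemma submod_opp V (K : submodClosed V) x : x \in K -> - x \in K.
Proof. by rewrite -scaleN1r; apply: rpredZ. Qed.

Lemma in_kernel U V (f : {linear U -> V}) x : (x \in kernel f) = (f x == 0).
Proof. by []. Qed.

Lemma quotmod_proj_eq0 V (K : submodClosed V) x :
  (quotmod_proj K x == 0) = (x \in K).
Proof.
rewrite -(linear0 (quotmod_proj K)) /quotmod_proj.
by rewrite -Quotient.idealrBE subr0.
Qed.

Lemma quotmod_proj_eq V (K : submodClosed V) x y :
  (quotmod_proj K x == quotmod_proj K y) = (x - y \in K).
Proof. by rewrite -subr_eq0 -linearB quotmod_proj_eq0. Qed.

Lemma quotmod_proj_surj V (K : submodClosed V) : surjective (quotmod_proj K).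
Proof. by move=> u; exists (repr u); rewrite quotmod_projP. Qed.

End Small.

(** * The Jacobson radical *)

Section Jacobson.
Variable S : pzRingType.
Implicit Types (I : submodClosed S^o) (x y : S).

Lemma sub_maximal_ideal I :
  1 \notin I -> exists2 L, maximal_submod L & {subset I <= L}.
Proof.
move=> I1.
have [|L [IL L1 maxL]] := @maximal_disjoint_submod _ _ I (eq^~ (1 : S^o)).
  by move=> x xI x1; case/negP: I1; rewrite -x1.
exists L => //; split=> [|L' LL' [w wL'] v vL'].
  by exists 1; apply/negP => /L1.
apply: contrapT => /negP /maxL[r [l [lL e1]]]; case/negP: wL'.
rewrite -[w]mulr1 -e1; apply: (rpredZ w).
by apply: rpredD; [exact: rpredZ | exact: LL'].
Qed.

Definition jacobson : {pred S^o} :=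
  [pred x | `[< forall I, maximal_submod I -> x \in I >]].

Lemma jacobsonP x :
  reflect (forall I, maximal_submod I -> (x : S^o) \in I) (x \in jacobson).
Proof. exact: asboolP. Qed.

Fact jacobson_submod_closed : submod_closed jacobson.
Proof.
split=> [|a x y]; first by apply/jacobsonP => I _; apply: rpred0.
move=> /jacobsonP Jx /jacobsonP Jy; apply/jacobsonP => I maxI.
by rewrite rpredD ?rpredZ ?Jx ?Jy.
Qed.

HB.instance Definition _ := GRing.isSubmodClosed.Build S S^o
  jacobson (GRing.submod_closed_semi jacobson_submod_closed).

Lemma ideal_mull I x y : y \in I -> x * y \in I.
Proof. exact: (rpredZ x). Qed.

Lemma colon_submod I x : is_submod (fun y : S^o => (y : S) * x \in I).
Proof.
split=> [|a y z Iy Iz]; first by rewrite mul0r; apply: rpred0.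
rewrite mulrDl -mulrA; apply: rpredD => //; exact: ideal_mull.
Qed.

(** S/(I : x) is isomorphic to the simple module S/I through right
    multiplication by x. This makes [jacobson] a right ideal. *)
Lemma colon_maximal I x : maximal_submod I -> x \notin I ->
  maximal_submod (submod_of (colon_submod I x) : submodClosed S^o).
Proof.
move=> maxI xI; split=> [|L sL [w wL] v vL].
  by exists 1; apply/submod_ofP; rewrite mul1r; apply/negP.
apply/submod_ofP; apply: contrapT => /negP vxI; case/negP: wL.
have [r wrI] := maximal_submodP (w * x : S^o) maxI vxI.
rewrite -(subrK (r *: v) w); apply: rpredD; last exact: rpredZ.
by apply/sL/submod_ofP; rewrite mulrBl -mulrA.
Qed.

Lemma jacobson_mulr x y : x \in jacobson -> x * y \in jacobson.
Proof.
move=> /jacobsonP Jx; apply/jacobsonP => I maxI.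
apply: contrapT => /negP xyI.
have [yI|yI] := boolP ((y : S^o) \in I); first by rewrite ideal_mull in xyI.
by have /Jx/submod_ofP := colon_maximal maxI yI; apply/negP.
Qed.

Lemma principal_submod x : is_submod (fun y : S^o => exists r, y = r * x).
Proof.
split=> [|a _ _ [r ->] [s ->]]; first by exists 0; rewrite mul0r.
by exists (a * r + s); rewrite mulrDl -mulrA.
Qed.

Lemma jacobson_linv x : x \in jacobson -> exists u, u * (1 - x) = 1.
Proof.
move=> Jx; apply: contrapT => noinv.
have /sub_maximal_ideal[I maxI sI] :
    (1 : S^o) \notin (submod_of (principal_submod (1 - x)) : {pred S^o}).
  by apply/negP => /submod_ofP[u e1]; apply: noinv; exists u.
have [[w /negP wI] _] := maxI; apply: wI.
rewrite -[w]mulr1; apply: ideal_mull; rewrite -[1](subrK x).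
apply: rpredD; first by apply/sI/submod_ofP; exists 1; rewrite mul1r.
exact: jacobsonP Jx _ maxI.
Qed.

(** The left inverse u of 1 - x is itself of the form 1 - x' with x' in the
    radical, hence has a left inverse, which must be 1 - x. *)
Lemma jacobson_rinv x : x \in jacobson -> exists u, (1 - x) * u = 1.
Proof.
move=> Jx; have [u u1] := jacobson_linv Jx; exists u.
have uE : u = 1 - - u * x.
  by rewrite mulNr opprK -[in RHS]u1 mulrBr mulr1 subrK.
have [w w1] := jacobson_linv (ideal_mull (- u) Jx : - u * x \in jacobson).
rewrite -uE in w1.
suff -> : 1 - x = w by [].
by rewrite -[RHS]mulr1 -[X in _ = _ * X]u1 mulrA w1 mul1r.
Qed.

(** If a finite row z satisfies z = z c with c a matrix over the radical, then
    z = 0: the diagonal entry 1 - c x x is invertible, so z x can be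
    eliminated, and the system obtained on the remaining entries again has its
    coefficients in the radical. *)
Lemma jacobson_nakayama (X : eqType) (s : seq X) (z : X -> S) :
  (forall x : X, x \in s -> exists c : X -> S,
     (forall y : X, c y \in jacobson) /\ z x = \sum_(y <- s) z y * c y) ->
  forall x : X, x \in s -> z x = 0.
Proof.
elim: s => [//|x s IH] zs.
have [c [Jc]] := zs x (mem_head _ _); rewrite big_cons => zx.
have [u u1] := jacobson_rinv (Jc x).
have {}zx : z x = \sum_(y <- s) z y * (c y * u).
  rewrite -[LHS]mulr1 -u1 mulrA mulrBr mulr1 [X in (X - _) * _]zx addrC addKr.
  by rewrite mulr_suml; apply: eq_bigr => y _; rewrite mulrA.
have zs0 (y : X) : y \in s -> z y = 0.
  apply: IH => {}y ys; have [|d [Jd]] := zs y; first by rewrite inE ys orbT.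
  rewrite big_cons => zy; exists (fun w => c w * u * d x + d w); split=> [w|].
    by apply: rpredD (Jd w); rewrite !jacobson_mulr.
  rewrite zy zx mulr_suml -big_split /=.
  by apply: eq_bigr => w _; rewrite mulrDr !mulrA.
move=> y; rewrite inE => /predU1P[->|/zs0 //].
by rewrite zx big1_seq // => w /andP[_ /zs0->]; rewrite mul0r.
Qed.

End Jacobson.

(** * Max-projective covers over a semilocal ring *)

Section LeftModules.
Variable S : pzRingType.
Implicit Types (M N P Q V : lmodType S) (I : submodClosed S^o).

(** Over S := R^c, this notion and the next two are by conversion those for
    right R-modules. *)
Definition lprojective P :=
  forall (A B : lmodType S) (g : {linear A -> B}) (f : {linear P -> B}),
    surjective g -> exists h : {linear P -> A}, f =1 g \o h.

Definition lmax_projective M :=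
  forall I, maximal_submod I ->
  forall f : {linear M -> quotmod I},
    exists g : {linear M -> S^o}, f =1 quotmod_proj I \o g.

Definition has_lmax_projective_cover M :=
  exists (P : lmodType S) (f : {linear P -> M}),
    [/\ lmax_projective P, surjective f & small (kernel f)].

Definition semisimple_covered :=
  forall M, semisimple M -> has_lmax_projective_cover M.

(** The class of v generates a simple or zero submodule of V/K. *)
Definition spans_simple V (K : submodClosed V) (v : V) :=
  exists2 I : submodClosed S^o, maximal_submod I &
    forall a : S, a \in I -> a *: v \in K.

Lemma quotmod_semisimple V (K : submodClosed V) :
  (forall v : V, exists2 s : seq (S * V), v = \sum_(x <- s) x.1 *: x.2 &
     forall x, x \in s -> spans_simple K x.2) ->
  semisimple (quotmod K).
Proof.
move=> gen u; have [v <-] := quotmod_proj_surj u; have [s -> sS] := gen v.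
exists [seq y <- [seq quotmod_proj K (x.1 *: x.2) | x <- s] | y != 0].
  rewrite linear_sum big_filter big_map.
  rewrite [LHS](bigID (fun x => quotmod_proj K (x.1 *: x.2) != 0)) /=.
  by rewrite [X in _ + X]big1 ?addr0 // => x /negPn/eqP.
move=> y; rewrite mem_filter => /andP[y0 /mapP[[r w] /sS/=[I maxI IK] yE]].
have Wax : is_submod (fun z => exists r, z = quotmod_proj K (r *: w)).
  split=> [|a _ _ [b ->] [c ->]]; first by exists 0; rewrite scale0r linear0.
  by exists (a * b + c); rewrite !linearZ /= scalerDl scalerA.
exists (submod_of Wax : submodClosed _); last by apply/submod_ofP; exists r.
split=> [|L LW]; first by exists y => //; apply/submod_ofP; exists r.
have [L0|/existsNP[x /not_implyP[xL x0]]] :=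
  pselect (forall x, x \in L -> x = 0); [by left | right=> _ /submod_ofP[b ->]].
have /submod_ofP[c xE] := LW _ xL.
have cI : (c : S^o) \notin I.
  by apply/negP => /IK cK; apply: x0; apply/eqP; rewrite xE quotmod_proj_eq0.
have [d /IK dK] := maximal_submodP (b : S^o) maxI cI.
suff -> : quotmod_proj K (b *: w) = d *: x by apply: rpredZ.
rewrite xE -linearZ; apply/eqP; rewrite quotmod_proj_eq.
by rewrite scalerA -scalerBl.
Qed.

(** S/J is a sum of simple modules; the pairs (r, a) stand for the terms of a
    decomposition of 1. *)
Definition semilocal := exists2 s : seq (S * S), 1 = \sum_(x <- s) x.1 * x.2 &
  forall x, x \in s -> spans_simple (@jacobson S) (x.2 : S^o).

Lemma semilocal_quotmod V (K : submodClosed V) : semilocal ->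
  (forall a v, a \in @jacobson S -> a *: v \in K) -> semisimple (quotmod K).
Proof.
move=> [s s1 sS] JK; apply: quotmod_semisimple => v.
exists [seq (x.1, x.2 *: v) | x <- s].
  rewrite big_map -[LHS]scale1r s1 scaler_suml.
  by apply: eq_bigr => x _; rewrite scalerA.
move=> _ /mapP[x /sS[I maxI IJ] ->]; exists I => // a /IJ/JK.
by rewrite scalerA; apply.
Qed.

(** If the elements of S spanning simple modules modulo J did not generate S,
    they would lie in some maximal I, but a lift to S of a max-projective cover
    of S/I yields such an element outside I. *)
Lemma covers_semilocal : semisimple_covered -> semilocal.
Proof.
move=> covers.
pose D (y : S^o) := exists2 s : seq (S * S), y = \sum_(x <- s) x.1 * x.2 &
  forall x, x \in s -> spans_simple (@jacobson S) (x.2 : S^o).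
have Dax : is_submod D.
  split=> [|a y z [s ys sS] [t zt tS]]; first by exists [::]; rewrite ?big_nil.
  exists ([seq (a * x.1, x.2) | x <- s] ++ t) => [|x].
    rewrite big_cat big_map ys zt; congr (_ + _).
    by rewrite scaler_sumr; apply: eq_bigr => x _; rewrite -mulrA.
  by rewrite mem_cat => /orP[/mapP[w /sS wS ->]|/tS].
apply: contrapT => notD.
have /sub_maximal_ideal[I maxI DI] :
    (1 : S^o) \notin (submod_of Dax : {pred S^o}).
  by apply/negP => /submod_ofP.
have [|P [f [maxP surjf smallf]]] := covers (quotmod I).
  apply: quotmod_semisimple => v; exists [:: (v : S, 1 : S^o)].
    by rewrite big_seq1 /= -[LHS]mulr1.
  move=> _ /predU1P[->|//]; exists I => // a aI /=.
  by rewrite -[_ *: _]/(a * 1) mulr1.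
have [y fy] := surjf (quotmod_proj I 1); have [g gf] := maxP I maxI f.
have gyI : (g y : S^o) \notin I.
  apply/negP; rewrite -quotmod_proj_eq0 -[quotmod_proj I _]gf fy.
  rewrite quotmod_proj_eq0 => I1.
  have [[w /negP wI] _] := maxI; apply: wI.
  by rewrite -[w]mulr1; apply: ideal_mull.
case/negP: gyI; apply/DI/submod_ofP; exists [:: (1, g y : S)].
  by rewrite big_seq1 mul1r.
move=> _ /predU1P[->|//]; exists I => // a aI /=; rewrite -linearZ.
apply/jacobsonP => L maxL; apply: (small_sub_maximal g smallf maxL).
rewrite in_kernel linearZ fy -linearZ quotmod_proj_eq0.
by rewrite -[_ *: _]/(a * 1) mulr1.
Qed.

(** Maps to S/I are handled through representatives: t is linear modulo I. *)
Lemma max_projective_lift P I (t : P -> S) :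
  lmax_projective P -> maximal_submod I ->
  (forall a x y, t (a *: x + y) - (a * t x + t y) \in I) ->
  exists g : {linear P -> S^o}, forall p, g p - t p \in I.
Proof.
move=> maxP maxI t_lin.
have f_lin : linear (fun p => quotmod_proj I (t p)).
  move=> a x y; rewrite -linearZ -linearD; apply/eqP.
  by rewrite quotmod_proj_eq.
have [g gE] := maxP I maxI (linear_of f_lin); exists g => p.
by rewrite -quotmod_proj_eq -[quotmod_proj I (g p)]gE.
Qed.

(** With 1 = sum r a and I a in J for a maximal I depending on (r, a), a lift h
    of t r modulo I makes h a a lift of t r a modulo J, and these add up. *)
Lemma max_projective_lift_jacobson P (t : P -> S) :
  semilocal -> lmax_projective P ->
  (forall a x y, t (a *: x + y) - (a * t x + t y) \in @jacobson S) ->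
  exists g : {linear P -> S^o}, forall p, g p - t p \in @jacobson S.
Proof.
move=> [s s1 sS] maxP t_lin.
suff [g gJ] : exists g : {linear P -> S^o}, forall p,
    g p - t p * (\sum_(x <- s) x.1 * x.2) \in @jacobson S.
  by exists g => p; rewrite -[t p]mulr1 s1.
elim: s sS {s1} => [|[r b] s IH] sS.
  exists \0 => p; rewrite big_nil mulr0 subrr; exact: rpred0.
have [|g gJ] := IH; first by move=> x xs; apply: sS; rewrite inE xs orbT.
have [I maxI IJ] := sS _ (mem_head _ _).
have [|h hI] := @max_projective_lift _ I (fun p => t p * r) maxP maxI.
  move=> a x y; rewrite mulrA -mulrDl -mulrBl.
  exact: jacobsonP (jacobson_mulr r (t_lin a x y)) _ maxI.
have k_lin : linear (fun p => (h p : S) * b + g p : S^o).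
  by move=> a x y; rewrite !linearP scalerDr [RHS]addrACA mulrDl -mulrA.
exists (linear_of k_lin) => p.
rewrite linear_ofE big_cons mulrDr opprD addrACA /=.
by apply: rpredD (gJ p); rewrite mulrA -mulrBl; exact: IJ (hI p).
Qed.

Lemma max_projective_pair P Q :
  lmax_projective P -> lmax_projective Q -> lmax_projective (P * Q)%type.
Proof.
move=> maxP maxQ I maxI f.
have l_lin : linear (fun p : P => f (p, 0)).
  move=> a x y; rewrite -linearP; congr (f _); congr pair.
  by rewrite /= scaler0 addr0.
have r_lin : linear (fun q : Q => f (0, q)).
  move=> a x y; rewrite -linearP; congr (f _); congr pair.
  by rewrite /= scaler0 addr0.
have [g gE] := maxP I maxI (linear_of l_lin).
have [h hE] := maxQ I maxI (linear_of r_lin).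
have k_lin : linear (fun x : (P * Q)%type => g x.1 + h x.2).
  by move=> a x y; rewrite !linearP scalerDr addrACA.
exists (linear_of k_lin) => x /=; rewrite linearD.
have -> : x = (x.1, 0) + (0, x.2).
  by case: x => x y; congr pair; rewrite /= ?addr0 ?add0r.
rewrite linearD /= addr0 add0r; congr (_ + _); [exact: gE | exact: hE].
Qed.

(** If ker h + L is everything, the smallness of ker f shows that L + 0 * ker g
    is everything, then the smallness of ker g that L is. *)
Lemma small_kernel_pair P Q M N (f : {linear P -> M}) (g : {linear Q -> N})
    (h : {linear (P * Q)%type -> (M * N)%type}) :
  (forall x, h x = (f x.1, g x.2)) ->
  small (kernel f) -> small (kernel g) -> small (kernel h).
Proof.
move=> hE smallf smallg L [w /negP wL] full; apply: wL; move: w.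
have l_lin : linear (fun p : P => (p, 0) : (P * Q)%type).
  by move=> a x y; congr pair; rewrite /= scaler0 addr0.
have r_lin : linear (fun q : Q => (0, q) : (P * Q)%type).
  by move=> a x y; congr pair; rewrite /= scaler0 addr0.
have Lax : is_submod (fun x : (P * Q)%type =>
    exists2 q, g q = 0 & x - (0, q) \in L).
  split=> [|a x y [q q0 qL] [q' q'0 q'L]].
    by exists 0; [exact: linear0 | rewrite (subrr (0 : (P * Q)%type)) rpred0].
  exists (a *: q + q'); first by rewrite linearP q0 q'0 scaler0 addr0.
  rewrite -[(0, _)]/(linear_of r_lin (a *: q + q')) linearP opprD addrACA.
  by rewrite -scalerBr; apply: rpredD => //; apply: rpredZ.
apply: (small_image (f := linear_of r_lin) smallg) => v.
have /submod_ofP[q q0 vL] : v \in (submod_of Lax : submodClosed _).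
  move: v; apply: (small_image (f := linear_of l_lin) smallf) => v.
  have [[p q] [l [+ lL ->]]] := full v.
  rewrite in_kernel hE => /eqP[/eqP fp gq].
  exists p, ((0, q) + l); split=> //; last first.
    by rewrite addrA; congr (_ + _); congr pair; rewrite /= ?addr0 ?add0r.
  by apply/submod_ofP; exists q => //; rewrite addrC addKr.
by exists q, (v - (0, q)); split; rewrite ?in_kernel ?q0 // addrC subrK.
Qed.

End LeftModules.

(** * Free modules *)

Section FreeModule.
Variables (S : pzRingType) (X : choiceType).

Definition finite_support_fun : {pred X -> S^o} :=
  [pred f | `[< exists s : seq X, forall x, x \notin s -> f x = 0 >]].

Fact finite_support_fun_closed : submod_closed finite_support_fun.
Proof.
split=> [|a f g]; first by apply/asboolP; exists [::].
move=> /asboolP[s f0] /asboolP[t g0]; apply/asboolP; exists (s ++ t) => x.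
rewrite mem_cat negb_or => /andP[/f0 fx /g0 gx].
by rewrite -[LHS]/(a *: f x + g x) fx gx scaler0 addr0.
Qed.

HB.instance Definition _ := GRing.isSubmodClosed.Build S (X -> S^o)
  finite_support_fun (GRing.submod_closed_semi finite_support_fun_closed).

Definition free_module := {f : X -> S^o | f \in finite_support_fun}.

HB.instance Definition _ := SubChoice.on free_module.
HB.instance Definition _ := [SubChoice_isSubLmodule of free_module by <:].

(** The codomain is S^o, for which coordinates are linear forms; the casts to S
    below let them act as scalars. *)
Definition coordinate (x : X) (z : free_module) : S^o := val z x.

Fact coordinate_linear x : linear (coordinate x).
Proof. by []. Qed.

HB.instance Definition _ x := GRing.isLinear.Build S free_module S^o *:%R
  (coordinate x) (coordinate_linear x).

Lemma coordinate_inj z z' :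
  (forall x, coordinate x z = coordinate x z') -> z = z'.
Proof. by move=> eq_zz'; apply/val_inj/funext => x; exact: eq_zz'. Qed.

Fact basis_finite x : (fun y => (x == y)%:R : S^o) \in finite_support_fun.
Proof.
apply/asboolP; exists [:: x] => y; rewrite inE eq_sym => /negPf xy.
by rewrite xy.
Qed.

Definition basis x : free_module :=
  exist (fun f => f \in finite_support_fun) _ (basis_finite x).

Lemma coordinate_basis x y : coordinate y (basis x) = (x == y)%:R :> S.
Proof. by []. Qed.

Lemma supportP (z : free_module) :
  {s : seq X | uniq s & forall x, x \notin s -> coordinate x z = 0}.
Proof.
have /asboolP/cid[s z0] : val z \in finite_support_fun := valP z.
exists (undup s); first exact: undup_uniq.
by move=> x; rewrite mem_undup => /z0.
Qed.

Definition supp z : seq X := s2val (supportP z).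

Lemma supp_uniq z : uniq (supp z). Proof. by rewrite /supp; case: supportP. Qed.

Lemma supp0 z x : x \notin supp z -> coordinate x z = 0.
Proof. by rewrite /supp; case: (supportP z) => s _ s0 /s0. Qed.

Section Lift.
Variables (V : lmodType S) (v : X -> V).

Definition free_lift z : V := \sum_(x <- supp z) (coordinate x z : S) *: v x.

(** The list [supp z] is an arbitrary choice; any other list containing the
    support gives the same sum. *)
Lemma free_liftE z (s : seq X) : uniq s ->
  (forall x, x \notin s -> coordinate x z = 0) ->
  free_lift z = \sum_(x <- s) (coordinate x z : S) *: v x.
Proof.
move=> s_uniq z0; pose nz x := (coordinate x z : S) != 0.
have sum_nz t : \sum_(x <- t) (coordinate x z : S) *: v x =
    \sum_(x <- filter nz t) (coordinate x z : S) *: v x.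
  rewrite big_filter [LHS](bigID nz) /= [X in _ + X]big1 ?addr0 // => x.
  by move=> /negPn/eqP->; rewrite scale0r.
rewrite /free_lift sum_nz [RHS]sum_nz; apply: perm_big; apply: uniq_perm.
- by rewrite filter_uniq ?supp_uniq.
- by rewrite filter_uniq.
move=> x; rewrite !mem_filter; apply: andb_id2l => zx.
have [xs|/z0 zx0] := boolP (x \in s); last by rewrite /nz zx0 eqxx in zx.
by apply: contraNT zx => /supp0->.
Qed.

Fact free_lift_linear : linear free_lift.
Proof.
move=> a z z'; pose s := undup (supp z ++ supp z').
have s0 w : {subset supp w <= supp z ++ supp z'} ->
    forall x, x \notin s -> coordinate x w = 0.
  by move=> sw x; rewrite mem_undup => /(contra (@sw x))/supp0.
have sz0 := s0 z (@mem_subseq _ _ _ (prefix_subseq _ _)).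
have sz'0 := s0 z' (@mem_subseq _ _ _ (suffix_subseq _ _)).
have sazz'0 x : x \notin s -> coordinate x (a *: z + z') = 0.
  by move=> xs; rewrite linearP /= sz0 // sz'0 // scaler0 addr0.
rewrite (free_liftE (undup_uniq _) sazz'0) (free_liftE (undup_uniq _) sz0).
rewrite (free_liftE (undup_uniq _) sz'0).
rewrite scaler_sumr -big_split; apply: eq_bigr => x _ /=.
by rewrite linearP scalerDl scalerA.
Qed.

HB.instance Definition _ := GRing.isLinear.Build S free_module V *:%R
  free_lift free_lift_linear.

Lemma free_lift_basis x : free_lift (basis x) = v x.
Proof.
rewrite (@free_liftE _ [:: x]) // => [|y].
  by rewrite big_seq1 coordinate_basis eqxx scale1r.
by rewrite inE coordinate_basis eq_sym => /negPf->.
Qed.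

End Lift.

Lemma basis_expansion z : z = free_lift basis z.
Proof.
apply: coordinate_inj => y; rewrite linear_sum /=.
have [ys|ys] := boolP (y \in supp z).
  rewrite (bigD1_seq y) ?supp_uniq //= linearZ /= coordinate_basis eqxx.
  rewrite -[_ *: _]/(_ * _) mulr1 big1 ?addr0 // => x /negPf xy.
  by rewrite linearZ /= coordinate_basis xy scaler0.
rewrite supp0 // big1_seq // => x /andP[_ xs].
have xy : x != y by apply: contraNneq ys => <-.
by rewrite linearZ /= coordinate_basis (negPf xy) scaler0.
Qed.

Lemma linear_basisE (V : lmodType S) (f : {linear free_module -> V}) z :
  f z = \sum_(x <- supp z) (coordinate x z : S) *: f (basis x).
Proof.
rewrite {1}[z]basis_expansion linear_sum.
by apply: eq_bigr => x _; rewrite linearZ.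
Qed.

Lemma free_projective : lprojective free_module.
Proof.
move=> A B g f surjg; have /choice[a ga] := fun x => surjg (f (basis x)).
exists (free_lift a) => z.
rewrite (linear_basisE f) /= linear_sum; apply: eq_bigr => x _.
by rewrite linearZ ga.
Qed.

(** If a quotient of F by a submodule of JF has a max-projective cover P, then
    P is isomorphic to F. Surjectivity of q comes from the smallness of ker f; for injectivity, lifts of the coordinates to
    linear forms on P turn a relation q z = 0 into a system z = z c with c over
    the radical. *)
Lemma cover_free_module (M P : lmodType S) (pi : {linear free_module -> M})
    (f : {linear P -> M}) :
  semilocal S -> lmax_projective P -> surjective pi ->
  (forall z, pi z = 0 -> forall x, coordinate x z \in @jacobson S) ->
  surjective f -> small (kernel f) ->
  exists (q : {linear free_module -> P}) (q' : {linear P -> free_module}),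
    [/\ cancel q q', cancel q' q & pi =1 f \o q].
Proof.
move=> semiS maxP surjpi kerpi surjf smallf.
have [q fq] := free_projective pi surjf; exists q.
have q_surj p : exists z, q z = p.
  have im_submod : is_submod (fun p => exists z, q z = p).
    split=> [|a _ _ [z <-] [z' <-]]; first by exists 0; rewrite linear0.
    by exists (a *: z + z'); rewrite linearP.
  suff /submod_ofP : p \in (submod_of im_submod : submodClosed P) by [].
  move: p; apply: (small_full smallf) => p; have [z zp] := surjpi (f p).
  exists (p - q z), (q z); split; rewrite ?subrK //.
    by rewrite in_kernel linearB subr_eq0 -zp fq.
  by apply/submod_ofP; exists z.
(* The choice t is linear modulo ker pi, hence its coordinates modulo J. *)
have /choice[t tE] := fun p => surjpi (f p).
have coordinate_lift x : exists g : {linear P -> S^o},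
    forall p, g p - coordinate x (t p) \in @jacobson S.
  apply: max_projective_lift_jacobson => // a p p'.
  have /kerpi/(_ x) : pi (t (a *: p + p') - (a *: t p + t p')) = 0.
    by rewrite linearB linearP !tE linearP subrr.
  by rewrite linearB linearP.
have q_inj : injective q.
  apply: raddf_inj => z qz; apply: coordinate_inj => x; rewrite linear0.
  have [xz|/supp0 //] := boolP (x \in supp z).
  move: x xz; apply: jacobson_nakayama => x xz.
  have [g gE] := coordinate_lift x.
  exists (fun y => (x == y)%:R - g (q (basis y))); split=> [y|].
    rewrite -opprB; set p := q (basis y).
    rewrite (_ : _ - _ = g p - coordinate x (t p)
      + coordinate x (t p - basis y)); last first.
      by rewrite linearB /= coordinate_basis addrA subrK eq_sym.
    rewrite -scaleN1r; apply: rpredZ; apply: rpredD => //; apply: kerpi.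
    by rewrite linearB tE fq subrr.
  have : g (q z) = 0 by rewrite [q z]qz linear0.
  rewrite (linear_basisE q z) linear_sum => e0.
  rewrite -[LHS]subr0 -[X in _ - X = _]e0.
  have {1}-> : coordinate x z =
      \sum_(y <- supp z) (coordinate y z : S) * (x == y)%:R.
    rewrite (bigD1_seq x) ?supp_uniq //= eqxx mulr1 big1 ?addr0 // => y.
    by rewrite eq_sym => /negPf->; rewrite mulr0.
  rewrite -sumrB; apply: eq_bigr => y _.
  by rewrite mulrBr !linearZ.
have /choice[q' q'K] := q_surj.
have q'_lin : linear q' by move=> a p p'; apply: q_inj; rewrite linearP !q'K.
by exists (linear_of q'_lin); split=> // z; apply: q_inj; rewrite q'K.
Qed.

End FreeModule.

(** * Projective covers of arbitrary modules *)

Section Perfect.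
Variable S : pzRingType.

Section FreeRadical.
Variable X : choiceType.
Local Notation F := (free_module S X).

Lemma free_radical_submod :
  is_submod (fun z : F => forall x, coordinate x z \in @jacobson S).
Proof.
split=> [x|a z w Jz Jw x]; first by apply: rpred0.
by rewrite linearP; apply: rpredD (Jw x); exact: (ideal_mull a (Jz x)).
Qed.

(** This is JF: elements of F have finite support, so one with coordinates in J
    is a combination of basis vectors with coefficients in J. *)
Definition free_radical : submodClosed F := submod_of free_radical_submod.

Lemma jacobson_free_radical (a : S) (z : F) :
  a \in @jacobson S -> a *: z \in free_radical.
Proof.
by move=> Ja; apply/submod_ofP => x; rewrite linearZ; exact: jacobson_mulr.
Qed.

(** The cover P of the semisimple module F/JF is F itself, so JF, which
    corresponds to the kernel of P -> F/JF, is small. *)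
Lemma free_radical_small : semisimple_covered S -> small free_radical.
Proof.
move=> covers; have semiS := covers_semilocal covers.
have ss := semilocal_quotmod semiS jacobson_free_radical.
have [P [f [maxP surjf smallf]]] := covers _ ss.
have kerpi z : quotmod_proj free_radical z = 0 ->
    forall x, coordinate x z \in @jacobson S.
  by move=> /eqP; rewrite quotmod_proj_eq0 => /submod_ofP.
have [q [q' [qK q'K fq]]] := cover_free_module semiS maxP
  (@quotmod_proj_surj _ _ free_radical) kerpi surjf smallf.
move=> L [w /negP wL] full; apply: wL; move: w.
apply: (small_image (f := q') smallf) => v; have [k [l [kJ lL ->]]] := full v.
exists (q k), l; rewrite qK; split=> //.
by rewrite in_kernel -[f (q k)]fq quotmod_proj_eq0.
Qed.

(** F/JF is semisimple, so a submodule disjoint from K modulo JF and maximal as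
    such is a complement: if v spans a simple module modulo JF and is not in
    K', then K' + S v meets K outside JF, and by simplicity v is in K + K'. *)
Lemma free_radical_complement (K : submodClosed F) :
  semilocal S -> {subset free_radical <= K} ->
  exists K' : submodClosed F, [/\ {subset free_radical <= K'}, addsm_full K K' &
    forall z, z \in K -> z \in K' -> z \in free_radical].
Proof.
move=> [s s1 sS] JK.
have [|K' [JK' K'E maxK']] := @maximal_disjoint_submod _ _ free_radical
    (fun z => z \in K /\ z \notin free_radical).
  by move=> x xJ [_]; rewrite xJ.
have KK' z : z \in K -> z \in K' -> z \in free_radical.
  by move=> zK zK'; apply: contrapT => /negP zJ; case: (K'E z).
exists K'; split=> // z.
have sum_submod : is_submod (fun z =>
    exists k l, [/\ k \in K, l \in K' & z = k + l]).
  split=> [|a _ _ [k [l [kK lK ->]]] [k' [l' [k'K l'K ->]]]].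
    by exists 0, 0; rewrite !rpred0 addr0.
  exists (a *: k + k'), (a *: l + l').
  by rewrite !(rpredD, rpredZ) // scalerDr addrACA.
suff /submod_ofP : z \in (submod_of sum_submod : submodClosed F) by [].
rewrite -[z]scale1r s1 scaler_suml big_seq.
apply: rpred_sum => -[c a] /sS/=[I maxI IJ].
rewrite -scalerA; apply: rpredZ; set v := a *: z.
have Iv b : (b : S^o) \in I -> b *: v \in free_radical.
  by move=> /IJ; rewrite /v scalerA; exact: jacobson_free_radical.
have [vK'|/maxK'[r [l [lK' [rK rJ]]]]] := boolP (v \in K').
  by apply/submod_ofP; exists 0, v; rewrite rpred0 add0r.
have rI : (r : S^o) \notin I.
  apply: contra rJ => rI; apply: KK' => //; rewrite rpredD //.
  exact: JK' (Iv _ rI).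
have [b /Iv bJ] : exists b : S, (1 - b * r : S^o) \in I.
  exact: maximal_submodP _ maxI rI.
apply/submod_ofP; exists (b *: (r *: v + l)), ((1 - b * r) *: v - b *: l).
split; [exact: rpredZ | |].
  by apply: rpredD; [exact: JK' | exact/submod_opp/rpredZ].
rewrite scalerBl scale1r scalerDr scalerA addrACA subrr addr0.
by rewrite [RHS]addrC subrK.
Qed.

End FreeRadical.

(** The pair of covers of F/K and F/K' is a cover of F/JF, so the cover of F/K
    is a direct summand of F, hence projective; it is carried over to N. *)
Lemma covers_lprojective_cover (N : lmodType S) :
  semisimple_covered S ->
  exists (P : lmodType S) (f : {linear P -> N}),
    [/\ lprojective P, surjective f & small (kernel f)].
Proof.
move=> covers; have semiS := covers_semilocal covers.
pose F := free_module S N; pose phi : {linear F -> N} := free_lift id.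
have phi_surj : surjective phi.
  by move=> n; exists (basis S n); apply: free_lift_basis.
have K_submod : is_submod (fun z : F =>
    exists2 w, phi w = 0 & z - w \in free_radical N).
  split=> [|a z z' [w w0 zw] [w' w'0 z'w']].
    by exists 0; [exact: linear0 | rewrite subr0 rpred0].
  exists (a *: w + w'); first by rewrite linearP w0 w'0 scaler0 addr0.
  by rewrite opprD addrACA -scalerBr rpredD ?rpredZ.
pose K : submodClosed F := submod_of K_submod.
have JK : {subset free_radical N <= K}.
  by move=> z zJ; apply/submod_ofP; exists 0; [exact: linear0 | rewrite subr0].
have [K' [JK' KK' capK]] := free_radical_complement semiS JK.
have ssK := semilocal_quotmod semiS
  (fun a z Ja => JK _ (jacobson_free_radical z Ja)).
have ssK' := semilocal_quotmod semiS
  (fun a z Ja => JK' _ (jacobson_free_radical z Ja)).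
have [P [f [maxP surjf smallf]]] := covers _ ssK.
have [P' [f' [maxP' surjf' smallf']]] := covers _ ssK'.
have pi_lin : linear (fun z => (quotmod_proj K z, quotmod_proj K' z)).
  by move=> a x y; rewrite !linearP.
have g_lin : linear (fun x : (P * P')%type => (f x.1, f' x.2)).
  by move=> a x y; rewrite /= !linearP.
have surjpi : surjective (linear_of pi_lin).
  move=> [u u']; have [z <-] := quotmod_proj_surj u.
  have [z' <-] := quotmod_proj_surj u'.
  have [k [l [kK lK' zz']]] := KK' (z - z').
  exists (z - k); congr pair; apply/eqP; rewrite quotmod_proj_eq.
    by rewrite addrC addKr submod_opp.
  by rewrite addrAC zz' addrC addKr.
have surjg : surjective (linear_of g_lin).
  move=> [u u']; have [p <-] := surjf u; have [p' <-] := surjf' u'.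
  by exists (p, p').
have kerpi z : linear_of pi_lin z = 0 ->
    forall x, coordinate x z \in @jacobson S.
  move=> [/eqP + /eqP]; rewrite !quotmod_proj_eq0 => zK zK'.
  by have /submod_ofP := capK _ zK zK'.
have [q [q' [_ q'K _]]] := cover_free_module semiS
  (max_projective_pair maxP maxP') surjpi kerpi surjg
  (small_kernel_pair (h := linear_of g_lin) (fun _ => erefl) smallf smallf').
(* P is a retract of the free module F through q and q'. *)
have projP : lprojective P.
  move=> A B b h surjb.
  have hq_lin : linear (fun z => h (q z).1) by move=> a x y; rewrite !linearP.
  have [e eE] := free_projective (linear_of hq_lin) surjb.
  have e'_lin : linear (fun p => e (q' (p, 0))).
    move=> a x y; rewrite -!linearP; congr (e (q' _)); congr pair.
    by rewrite /= scaler0 addr0.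
  exists (linear_of e'_lin) => p /=.
  by rewrite -[RHS]eE linear_ofE q'K.
have [h fh] := projP _ _ _ f (@quotmod_proj_surj _ _ K).
have psi_lin : linear (fun p => phi (h p)) by move=> a x y; rewrite !linearP.
exists P, (linear_of psi_lin); split=> //; last first.
  apply: small_sub smallf => p; rewrite !in_kernel linear_ofE => /eqP phi0.
  rewrite fh /= quotmod_proj_eq0; apply/submod_ofP; exists (h p) => //.
  by rewrite subrr rpred0.
have im_submod : is_submod (fun z : F => exists p, phi (h p) = phi z).
  split=> [|a z z' [p pz] [p' p'z']]; first by exists 0; rewrite !linear0.
  by exists (a *: p + p'); rewrite !linearP pz p'z'.
move=> n; have [z <-] := phi_surj n.
suff /submod_ofP : z \in (submod_of im_submod : submodClosed F) by [].
move: z; apply: (small_full (free_radical_small covers)) => z.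
have [p fp] := surjf (quotmod_proj K z).
have : z - h p \in K by rewrite -quotmod_proj_eq -fp fh.
(* z differs from h p by w in ker phi up to JF. *)
move=> /submod_ofP[w w0 wJ]; exists (z - h p - w), (h p + w); split=> //.
  by apply/submod_ofP; exists p; rewrite linearD w0 addr0.
by rewrite [h p + w]addrC addrA subrK subrK.
Qed.

End Perfect.

Theorem proposition10 (R : pzRingType) :
  [<-> right_perfect R;
       forall M : rmodType R, has_max_projective_cover M;
       forall M : rmodType R, semisimple M -> has_max_projective_cover M].
Proof.
tfae=> [perfect M|covers M _|covers M]; last first.
- exact: (@covers_lprojective_cover R^c).
- exact: covers.
have [P [f [projP surjf smallf]]] := perfect M; exists P, f; split=> // I _ g.
exact: projP (@quotmod_proj_surj _ _ I).
Qed.
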